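(* Assume: (i) for all $m\in\{1,\dots,d\}$ and all $u,v\in\mathcal{V}$, $$\Big\langle u,\frac{\partial v}{\partial\hat x_m}\Big\rangle_{\mathbf W}+\Big\langle\frac{\partial u}{\partial\hat x_m},v\Big\rangle_{\mathbf W}=\sum_{\gamma=1}^{N_f}\hat n^{(\gamma)}_m\langle u,v\rangle_{\mathbf W^{(\gamma)}};$$ (ii) $\mathbf V$ has rank $N_p$, and $\mathbf W$ and all $\mathbf W^{(\gamma)}$, $\gamma\in\{1,\dots,N_f\}$, are symmetric positive definite; (iii) $\mathbf M^{(\kappa)}$ is invertible for all $\kappa\in\{1,\dots,K\}$. Then the strong-form discontinuous Galerkin (DG) method $$\mathbf M^{(\kappa)}\frac{d u^{(h,\kappa,e)}}{dt}+\sum_{m=1}^d\mathbf M\mathbf D^{(m)}\mathbf P f^{(h,\kappa,m,e)}+\sum_{\gamma=1}^{N_f}(\mathbf V^{(\gamma)})^T\mathbf W^{(\gamma)}\Big(f^{( *,\kappa,\gamma,e)}-\sum_{n=1}^d\hat n^{(\gamma)}_n\mathbf V^{(\gamma)}\mathbf P f^{(h,\kappa,n,e)}\Big)=0$$ (for all $\kappa\in\{1,\dots,K\}$, $e\in\{1,\dots,N_{\rm Eq}\}$, $t\in(0,T)$) is equivalent to the weak-form DG method $$\mathbf M^{(\kappa)}\frac{d u^{(h,\kappa,e)}}{dt}-\sum_{m=1}^d(\mathbf D^{(m)})^T\mathbf V^T\mathbf W f^{(h,\kappa,m,e)}+\sum_{\gamma=1}^{N_f}(\mathbf V^{(\gamma)})^T\mathbf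 W^{(\gamma)}f^{( *,\kappa,\gamma,e)}=0$$ (for all $\kappa,e,t$), i.e. a family of coefficient vectors $u^{(h,\kappa,e)}(t)$ satisfies one system if and only if it satisfies the other.
   Context: Reference element and operators. $\hat\Omega\subset\mathbb{R}^d$ is a polytope with flat facets $\hat\Gamma^{(\gamma)}$, $\gamma\in\{1,\dots,N_f\}$, and outward unit normals $\hat n^{(\gamma)}$. $\mathcal{V}$ is the space of real polynomial functions on $\hat\Omega$ spanned by the monomials with exponents in a finite set $\mathcal{N}\supseteq\{\alpha\in\mathbb{N}_0^d:|\alpha|\le p\}$ of $N_p$ multi-indices ($p\in\mathbb{N}_0$); $\mathcal{V}$ is assumed closed under each $\partial/\partial\hat x_m$ and contains the constants. $\{\phi^{(i)}\}_{i=1}^{N_p}$ is an arbitrary basis of $\mathcal{V}$. Volume nodes $\hat x^{(i)}\in\hat\Omega$, $i\in\{1,\dots,N\}$ ($N\ge N_p$), facet nodes $\hat x^{(\gamma,i)}\in\hat\Gamma^{(\gamma)}$, $i\in\{1,\dots,N_\gamma\}$, and matrices $\mathbf W\in\mathbb{R}^{N\times N}$, $\mathbf W^{(\gamma)}\in\mathbb{R}^{N_\gamma\times N_\gamma}$ are given; $\langle u,v\rangle_{\mathbf W}:=\sum_{i,j}u(\hat x^{(i)})W_{ij}v(\hat x^{(j)})$ and $\langle u,v\rangle_{\mathbf W^{(\gamma)}}:=\sum_{i,j}u(\hat x^{(\gamma,i)})W^{(\gamma)}_{ij}v(\hat x^{(\gamma,j)})$. Set $V_{ij}:=\phi^{(j)}(\hat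 x^{(i)})$, $V^{(\gamma)}_{ij}:=\phi^{(j)}(\hat x^{(\gamma,i)})$, $\mathbf M:=\mathbf V^T\mathbf W\mathbf V$, $\mathbf P:=\mathbf M^{-1}\mathbf V^T\mathbf W$, and define $\mathbf D^{(m)}$ by $\partial\phi^{(j)}/\partial\hat x_m=\sum_iD^{(m)}_{ij}\phi^{(i)}$. Mesh. $\bar\Omega\subset\mathbb{R}^d$ is the union of compact elements $\Omega^{(\kappa)}$, $\kappa\in\{1,\dots,K\}$, with disjoint interiors, each the image of $\hat\Omega$ under a smooth bijective time-independent map $X^{(\kappa)}$ with Jacobian matrix $\boldsymbol{\mathcal J}^{(\kappa)}$ and $\mathcal J^{(\kappa)}:=\det\boldsymbol{\mathcal J}^{(\kappa)}>0$; $\Gamma^{(\kappa,\gamma)}:=X^{(\kappa)}(\hat\Gamma^{(\gamma)})$ has outward unit normal $n^{(\kappa,\gamma)}$, and $\mathcal J^{(\kappa,\gamma)}(\hat x):=\|\mathcal J^{(\kappa)}(\hat x)(\boldsymbol{\mathcal J}^{(\kappa)}(\hat x))^{-T}\hat n^{(\gamma)}\|_2$. $\mathbf J^{(\kappa)}:=\mathrm{diag}(\mathcal J^{(\kappa)}(\hat x^{(1)}),\dots,\mathcal J^{(\kappa)}(\hat x^{(N)}))$ and $\mathbf M^{(\kappa)}:=\mathbf V^T\mathbf W\mathbf J^{(\kappa)}\mathbf V$. Semi-discrete quantities. The conservation law is $\partial_tU+\sum_{m=1}^d\partial_{x_m}F^{(m)}(U)=0$ with $U\in\Upsilon\subseteq\mathbb{R}^{N_{\rm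 Eq}}$ and $F^{(m)}:\Upsilon\to\mathbb{R}^{N_{\rm Eq}}$. Unknown (differentiable in $t$) vectors $u^{(h,\kappa,e)}(t)\in\mathbb{R}^{N_p}$ define $U^{(h,\kappa)}_e(\hat x,t)=\sum_iu^{(h,\kappa,e)}_i(t)\phi^{(i)}(\hat x)$, assumed to take values in $\Upsilon$. The vector $f^{(h,\kappa,m,e)}(t)\in\mathbb{R}^N$ has entries equal to the $e$-th component of $\sum_{n=1}^d\mathcal J^{(\kappa)}[(\boldsymbol{\mathcal J}^{(\kappa)})^{-1}]_{mn}F^{(n)}(U^{(h,\kappa)})$ at the nodes $\hat x^{(i)}$; the vector $f^{( *,\kappa,\gamma,e)}(t)\in\mathbb{R}^{N_\gamma}$ has entries equal to the $e$-th component of $\mathcal J^{(\kappa,\gamma)}F^*(U^{(h,\kappa)},U^{(+,\kappa,\gamma)},n^{(\kappa,\gamma)}\circ X^{(\kappa)})$ at the nodes $\hat x^{(\gamma,i)}$, where $F^*:\Upsilon\times\Upsilon\times\mathbb{S}^{d-1}\to\mathbb{R}^{N_{\rm Eq}}$ is a consistent and conservative numerical flux and $U^{(+,\kappa,\gamma)}$ is external (neighbour or boundary) data. *)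

(* Defs.v *)
From HB Require Import structures.
From mathcomp Require Import all_boot all_order all_algebra.
From mathcomp Require Import finmap.
From mathcomp Require Import boolp classical_sets functions reals topology.
From mathcomp Require Import normedtype derive.

Set Implicit Arguments.
Unset Strict Implicit.
Unset Printing Implicit Defensive.

Import Order.TTheory GRing.Theory Num.Theory.
Import numFieldNormedType.Exports.

Local Open Scope classical_set_scope.
Local Open Scope ring_scope.

(* Points and normals are row vectors; nodal values and expansion coefficients
   are column vectors. *)

Section Euclidean.
Context {R : realType} {d : nat}.
Implicit Types (x y v : 'rV[R]_d) (A : set 'rV[R]_d).

Definition dotv x y : R := \sum_i x 0 i * y 0 i.

(* The library norm on 'rV[R]_d is the sup norm. *)
Definition norm2 x : R := Num.sqrt (dotv x x).

Definition partial (m : 'I_d) (f : 'rV[R]_d -> R) : 'rV[R]_d -> R :=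
  fun x => 'D_(delta_mx 0 m) f x.

(* C^infinity on U, for open U: all iterated partial derivatives are
   differentiable. *)
Definition smooth_on (U : set 'rV[R]_d) (f : 'rV[R]_d -> R) : Prop :=
  forall (s : seq 'I_d) x, U x -> differentiable (foldr partial f s) x.

(* Interior of G relative to the hyperplane orthogonal to v, when G is contained
   in such a hyperplane. *)
Definition relint v (G : set 'rV[R]_d) : set 'rV[R]_d :=
  [set x | G x /\ \forall y \near x, dotv v (y - x) = 0 -> G y].

(* A full-dimensional polytope, not assumed convex, with its facets and outward
   unit normals.  A compact regular closed set whose boundary lies in finitely
   many hyperplanes is a finite union of convex polytopes. *)
Record is_polytope (Nf : nat) (Omega : set 'rV[R]_d)
    (facet : 'I_Nf -> set 'rV[R]_d) (nrm : 'I_Nf -> 'rV[R]_d) : Prop := {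
  polytope_compact : compact Omega;
  polytope_solid : Omega° !=set0;
  polytope_regular : Omega = closure Omega°;
  polytope_boundary : Omega `\` Omega° = \bigcup_g facet g;
  facet_flat : forall g, exists c : R, forall x, facet g x -> dotv (nrm g) x = c;
  facet_nonempty : forall g, facet g !=set0;
  facet_regular : forall g, facet g = closure (relint (nrm g) (facet g));
  facet_disjoint : forall g g', g != g' ->
    relint (nrm g) (facet g) `&` relint (nrm g') (facet g') = set0;
  normal_unit : forall g, norm2 (nrm g) = 1;
  normal_outward : forall g x, relint (nrm g) (facet g) x ->
    (forall g', g' != g -> ~ facet g' x) ->
    exists2 eps : R, 0 < eps & forall s : R, 0 < s < eps ->
      Omega° (x - s *: nrm g) /\ ~ Omega (x + s *: nrm g) }.

End Euclidean.

Section Polynomials.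
Context {R : realType} {d : nat}.

Definition monomial (a : {ffun 'I_d -> nat}) (x : 'rV[R]_d) : R :=
  \prod_i x 0 i ^+ a i.

(* Polynomial functions on a set with nonempty interior are identified with the
   polynomial functions on R^d extending them. *)
Definition monomial_span (E : {fset {ffun 'I_d -> nat}}) :
    set ('rV[R]_d -> R) :=
  [set v | exists c : {ffun 'I_d -> nat} -> R,
     forall x, v x = \sum_(a <- E) c a * monomial a x].

Definition is_basis (Np : nat) (V : set ('rV[R]_d -> R))
    (phi : 'I_Np -> 'rV[R]_d -> R) : Prop :=
  (forall i, V (phi i)) /\
  (forall v, V v -> exists! c : 'cV[R]_Np,
     forall x, v x = \sum_i c i 0 * phi i x).

End Polynomials.

Section Matrices.
Context {R : realType} {d : nat}.

Definition spd n (A : 'M[R]_n) : Prop :=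
  A^T = A /\ forall x : 'cV[R]_n, x != 0 -> 0 < (x^T *m A *m x) 0 0.

Definition nodal_form n (x : 'I_n -> 'rV[R]_d) (W : 'M[R]_n)
    (u v : 'rV[R]_d -> R) : R :=
  \sum_i \sum_j u (x i) * W i j * v (x j).

Definition vander n Np (phi : 'I_Np -> 'rV[R]_d -> R) (x : 'I_n -> 'rV[R]_d) :
    'M[R]_(n, Np) :=
  \matrix_(i, j) phi j (x i).

Definition massmx n Np (V : 'M[R]_(n, Np)) (W : 'M[R]_n) : 'M[R]_Np :=
  V^T *m W *m V.

Definition projmx n Np (V : 'M[R]_(n, Np)) (W : 'M[R]_n) : 'M[R]_(Np, n) :=
  invmx (massmx V W) *m V^T *m W.

End Matrices.

Section Mesh.
Context {R : realType} {d : nat}.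
Implicit Types (X : 'rV[R]_d -> 'rV[R]_d).

(* The library Jacobian acts on row vectors from the right; its transpose has
   entries (jac X x) i j = d X_i / d x_j. *)
Definition jac X (x : 'rV[R]_d) : 'M[R]_d := ('J X x)^T.

Definition detjac X (x : 'rV[R]_d) : R := \det (jac X x).

(* As a row vector, J^-T n is n *m J^-1. *)
Definition facet_jac X (n x : 'rV[R]_d) : R :=
  norm2 (detjac X x *: (n *m invmx (jac X x))).

Definition phys_massmx n Np (V : 'M[R]_(n, Np)) (W : 'M[R]_n)
    X (x : 'I_n -> 'rV[R]_d) : 'M[R]_Np :=
  V^T *m W *m diag_mx (\row_i detjac X (x i)) *m V.

(* Only the values of X k on Omegahat are meaningful; X k is a smooth extension
   to a neighbourhood.  As Omegahat is the closure of its interior, the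
   derivatives on Omegahat do not depend on the extension. *)
Record is_mesh (K : nat) (Omegahat Omegabar : set 'rV[R]_d)
    (elem : 'I_K -> set 'rV[R]_d) (X : 'I_K -> 'rV[R]_d -> 'rV[R]_d) : Prop := {
  mesh_cover : Omegabar = \bigcup_k elem k;
  mesh_compact : forall k, compact (elem k);
  mesh_disjoint : forall k k', k != k' -> (elem k)° `&` (elem k')° = set0;
  mesh_smooth : forall k, exists U : set 'rV[R]_d,
    [/\ open U, Omegahat `<=` U &
        forall i, smooth_on U (fun x => X k x 0 i)];
  mesh_bij : forall k, set_bij Omegahat (elem k) (X k);
  mesh_detjac : forall k x, Omegahat x -> 0 < detjac (X k) x }.

(* nu is the outward unit normal of the curved facet X @` G, where G is a flat
   facet of the reference element with outward normal nhat: the tangent space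
   at X x is spanned by the 'D_v X x with v orthogonal to nhat, and 'D_nhat X x
   points out of the element. *)
Definition outward_unit_normal X (G : set 'rV[R]_d) (nhat : 'rV[R]_d)
    (nu : 'rV[R]_d -> 'rV[R]_d) : Prop :=
  forall x, G x ->
    [/\ norm2 (nu (X x)) = 1,
        forall v, dotv v nhat = 0 -> dotv (nu (X x)) ('D_v X x) = 0 &
        0 < dotv (nu (X x)) ('D_nhat X x)].

End Mesh.

Section Semidiscrete.
Context {R : realType} {d NEq K Np : nat}.
Notation point := 'rV[R]_d.
Notation state := 'rV[R]_NEq.

Definition consistent_flux (Ups : set state) (F : 'I_d -> state -> state)
    (Fs : state -> state -> point -> state) : Prop :=
  forall U n, Ups U -> norm2 n = 1 -> Fs U U n = \sum_m n 0 m *: F m U.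

Definition conservative_flux (Ups : set state)
    (Fs : state -> state -> point -> state) : Prop :=
  forall U1 U2 n, Ups U1 -> Ups U2 -> norm2 n = 1 ->
    Fs U1 U2 n = - Fs U2 U1 (- n).

(* The coefficient vectors, as functions of the element, the equation and time. *)
Definition coeffs := 'I_K -> 'I_NEq -> R -> 'cV[R]_Np.

Definition Uh (phi : 'I_Np -> point -> R) (u : coeffs) (k : 'I_K)
    (x : point) (t : R) : state :=
  \row_e \sum_i u k e t i 0 * phi i x.

Definition admissible (Omegahat : set point) (Ups : set state)
    (phi : 'I_Np -> point -> R) (T : R) (u : coeffs) : Prop :=
  (forall k e (t : R), 0 < t < T -> derivable (u k e) t 1) /\
  (forall k x (t : R), Omegahat x -> 0 < t < T -> Ups (Uh phi u k x t)).

Definition vol_flux n (phi : 'I_Np -> point -> R) (x : 'I_n -> point)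
    (X : 'I_K -> point -> point) (F : 'I_d -> state -> state)
    (u : coeffs) (k : 'I_K) (m : 'I_d) (e : 'I_NEq) (t : R) : 'cV[R]_n :=
  \col_i (\sum_l (detjac (X k) (x i) * invmx (jac (X k) (x i)) m l)
            *: F l (Uh phi u k (x i) t)) 0 e.

(* nhat is the reference normal of the facet, nu the physical normal and Up the
   external state, as a function of reference coordinates and time. *)
Definition num_flux n (phi : 'I_Np -> point -> R) (x : 'I_n -> point)
    (X : 'I_K -> point -> point) (Fs : state -> state -> point -> state)
    (nhat : point) (nu : point -> point) (Up : point -> R -> state)
    (u : coeffs) (k : 'I_K) (e : 'I_NEq) (t : R) : 'cV[R]_n :=
  \col_i (facet_jac (X k) nhat (x i)
            *: Fs (Uh phi u k (x i) t) (Up (x i) t) (nu (X k (x i)))) 0 e.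

End Semidiscrete.
Arguments coeffs : clear implicits.

(* Main.v *)
Require Import Defs.
From HB Require Import structures.
From mathcomp Require Import all_boot all_order all_algebra.
From mathcomp Require Import finmap.
From mathcomp Require Import boolp classical_sets functions reals topology.
From mathcomp Require Import normedtype derive.

Set Implicit Arguments.
Unset Strict Implicit.
Unset Printing Implicit Defensive.

Import Order.TTheory GRing.Theory Num.Theory.
Import numFieldNormedType.Exports.

Local Open Scope classical_set_scope.
Local Open Scope ring_scope.

(** Both methods contain the same mass term and the same numerical flux term, so
    only the discrete divergences have to be compared.  In the basis [phi],
    hypothesis (i) is the matrix identity
      [M D_m + D_m^T M = \sum_g nhat_gm Vf_g^T Wf_g Vf_g]
    (lemma [summation_by_parts]): the entries of [M] are discrete inner products
    of basis functions, and multiplication by [D_m] turns the nodal values of the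
    basis into those of its derivatives.  Multiply this identity by [P f_m].  As
    [P] is the [W]-orthogonal projection, [M P = V^T W] (lemma
    [massmx_projmx]), so [M D_m P f_m] is [- D_m^T V^T W f_m] plus facet terms.
    Summed over [m], these facet terms are exactly the ones that the strong form
    subtracts from the numerical flux (lemma [strong_weak_residual]).  The two
    left-hand sides are therefore equal at every time, for every family of
    coefficient vectors. *)

(** A vector [x] in the kernel of [V^T W V] satisfies
    [(V x)^T W (V x) = 0], so [V x = 0] because [W] is definite, and [x = 0]
    because the columns of [V] are independent. *)
Lemma massmx_unit (R : realType) n Np (V : 'M[R]_(n, Np)) (W : 'M[R]_n) :
  \rank V = Np -> spd W -> massmx V W \in unitmx.
Proof.
move=> rV [WT Wpos].
have injV : row_free V^T by rewrite /row_free mxrank_tr rV.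
rewrite -row_free_unit; apply/inj_row_free => v vM0.
suff VvT0 : V *m v^T = 0.
  by apply: (row_free_inj injV); rewrite mul0mx -[v]trmxK -trmx_mul VvT0 trmx0.
apply/eqP; apply: contraT => /Wpos.
suff -> : (V *m v^T)^T *m W *m (V *m v^T) = v *m massmx V W *m v^T.
  by rewrite vM0 mul0mx mxE ltxx.
by rewrite trmx_mul trmxK /massmx !mulmxA.
Qed.

Lemma massmx_projmx (R : realType) n Np (V : 'M[R]_(n, Np)) (W : 'M[R]_n) :
  \rank V = Np -> spd W -> massmx V W *m projmx V W = V^T *m W.
Proof.
by move=> rV spdW; rewrite /projmx !mulmxA mulmxV ?mul1mx ?massmx_unit.
Qed.

(** The two families may differ, so that one of them can consist of derivatives
    of the other. *)
Lemma nodal_form_vander (R : realType) d n Np (x : 'I_n -> 'rV[R]_d)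
    (W : 'M[R]_n) (psi chi : 'I_Np -> 'rV[R]_d -> R) i j :
  nodal_form x W (psi i) (chi j) = ((vander psi x)^T *m W *m vander chi x) i j.
Proof.
rewrite /nodal_form exchange_big mxE; apply: eq_bigr => l _.
by rewrite !mxE mulr_suml; apply: eq_bigr => k _; rewrite !mxE.
Qed.

Lemma vander_partial (R : realType) d n Np (phi : 'I_Np -> 'rV[R]_d -> R)
    (x : 'I_n -> 'rV[R]_d) m (Dm : 'M[R]_Np) :
  (forall j y, partial m (phi j) y = \sum_i Dm i j * phi i y) ->
  vander (fun j => partial m (phi j)) x = vander phi x *m Dm.
Proof.
move=> hD; apply/matrixP => i j; rewrite !mxE hD.
by apply: eq_bigr => l _; rewrite mxE mulrC.
Qed.

(** By bilinearity a discrete integration by parts formula on a span is the same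
    as its instances on pairs of basis functions, which are the entries of this
    matrix identity. *)
Lemma summation_by_parts (R : realType) d Nf n Np
    (phi : 'I_Np -> 'rV[R]_d -> R) (x : 'I_n -> 'rV[R]_d) (W : 'M[R]_n)
    (Ng : 'I_Nf -> nat) (xf : forall g, 'I_(Ng g) -> 'rV[R]_d)
    (Wf : forall g, 'M[R]_(Ng g)) (b : 'I_Nf -> R) m (Dm : 'M[R]_Np) :
  (forall j y, partial m (phi j) y = \sum_i Dm i j * phi i y) ->
  (forall i j, nodal_form x W (phi i) (partial m (phi j))
             + nodal_form x W (partial m (phi i)) (phi j)
     = \sum_g b g * nodal_form (xf g) (Wf g) (phi i) (phi j)) ->
  massmx (vander phi x) W *m Dm + Dm^T *m massmx (vander phi x) W
  = \sum_g b g *: massmx (vander phi (xf g)) (Wf g).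
Proof.
move=> hD ibp; apply/matrixP => i j; rewrite summxE.
under eq_bigr do rewrite mxE -nodal_form_vander.
pose dphi l := partial m (phi l).
rewrite -ibp (nodal_form_vander x W phi dphi) (nodal_form_vander x W dphi phi).
by rewrite (vander_partial x hD) trmx_mul /massmx !mulmxA mxE.
Qed.

(** Only the algebra of the operators enters: [A] is the common time-derivative
    term, [b g m] the components of the normals, and the volume flux [f] and
    facet flux [fs] are arbitrary vectors. *)
Lemma strong_weak_residual (R : realType) d Nf n Np (V : 'M[R]_(n, Np))
    (W : 'M[R]_n) (Ng : 'I_Nf -> nat) (Vf : forall g, 'M[R]_(Ng g, Np))
    (Wf : forall g, 'M[R]_(Ng g)) (b : 'I_Nf -> 'I_d -> R)
    (D : 'I_d -> 'M[R]_Np) (A : 'cV[R]_Np) (f : 'I_d -> 'cV[R]_n)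
    (fs : forall g, 'cV[R]_(Ng g)) :
  \rank V = Np -> spd W ->
  (forall m, massmx V W *m D m + (D m)^T *m massmx V W
             = \sum_g b g m *: massmx (Vf g) (Wf g)) ->
  A + \sum_m massmx V W *m D m *m projmx V W *m f m
    + \sum_g (Vf g)^T *m Wf g *m
        (fs g - \sum_m b g m *: (Vf g *m projmx V W *m f m))
  = A - \sum_m (D m)^T *m V^T *m W *m f m
    + \sum_g (Vf g)^T *m Wf g *m fs g.
Proof.
move=> rV spdW sbp.
pose B m : 'cV_Np :=
  \sum_g b g m *: (massmx (Vf g) (Wf g) *m projmx V W *m f m).
have volE m : massmx V W *m D m *m projmx V W *m f m
    = B m - (D m)^T *m V^T *m W *m f m.
  have /(canRL (addrK _)) -> := sbp m.
  rewrite !mulmxBl -(mulmxA _ (massmx V W)) massmx_projmx // mulmxA; congr (_ - _).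
  by rewrite !mulmx_suml; apply: eq_bigr => g _; rewrite -!scalemxAl.
have facetE : \sum_g (Vf g)^T *m Wf g *m
        (fs g - \sum_m b g m *: (Vf g *m projmx V W *m f m))
    = \sum_g (Vf g)^T *m Wf g *m fs g - \sum_m B m.
  rewrite /B exchange_big -sumrB; apply: eq_bigr => g _.
  rewrite mulmxBr mulmx_sumr; congr (_ - _); apply: eq_bigr => m _.
  by rewrite -scalemxAr !mulmxA.
rewrite facetE (eq_bigr _ (fun m _ => volE m)) sumrB.
by rewrite addrA (addrAC _ _ (- \sum_m B m)) addrA (addrAC A) addrK.
Qed.

Theorem theorem4p1 (R : realType) (d Nf p N Np K NEq : nat)
  (* reference element *)
  (Omegahat : set 'rV[R]_d) (Gammahat : 'I_Nf -> set 'rV[R]_d)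
  (nhat : 'I_Nf -> 'rV[R]_d)
  (hOmegahat : is_polytope Omegahat Gammahat nhat)
  (* polynomial space and basis *)
  (E : {fset {ffun 'I_d -> nat}})
  (hE : forall a : {ffun 'I_d -> nat}, (\sum_i a i <= p)%N -> a \in E)
  (hNp : #|` E| = Np)
  (hclosed : forall (m : 'I_d) (v : 'rV[R]_d -> R),
     monomial_span E v -> monomial_span E (partial m v))
  (phi : 'I_Np -> 'rV[R]_d -> R) (hphi : is_basis (monomial_span E) phi)
  (* nodes and weight matrices *)
  (hN : (Np <= N)%N)
  (xv : 'I_N -> 'rV[R]_d) (hxv : forall i, Omegahat (xv i))
  (Ng : 'I_Nf -> nat)
  (xf : forall g, 'I_(Ng g) -> 'rV[R]_d) (hxf : forall g i, Gammahat g (xf g i))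
  (W : 'M[R]_N) (Wf : forall g, 'M[R]_(Ng g))
  (* differentiation matrices *)
  (D : 'I_d -> 'M[R]_Np)
  (hD : forall m j x, partial m (phi j) x = \sum_i D m i j * phi i x)
  (* mesh *)
  (Omegabar : set 'rV[R]_d) (elem : 'I_K -> set 'rV[R]_d)
  (X : 'I_K -> 'rV[R]_d -> 'rV[R]_d)
  (hmesh : is_mesh Omegahat Omegabar elem X)
  (nu : 'I_K -> 'I_Nf -> 'rV[R]_d -> 'rV[R]_d)
  (hnu : forall k g, outward_unit_normal (X k) (Gammahat g) (nhat g) (nu k g))
  (* conservation law, numerical flux, time interval and external states *)
  (Ups : set 'rV[R]_NEq) (F : 'I_d -> 'rV[R]_NEq -> 'rV[R]_NEq)
  (Fstar : 'rV[R]_NEq -> 'rV[R]_NEq -> 'rV[R]_d -> 'rV[R]_NEq)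
  (hcons : consistent_flux Ups F Fstar) (hconserv : conservative_flux Ups Fstar)
  (T : R) (hT : 0 < T)
  (Uplus : coeffs R NEq K Np -> 'I_K -> 'I_Nf -> 'rV[R]_d -> R -> 'rV[R]_NEq)
  (hUplus : forall u, admissible Omegahat Ups phi T u ->
     forall k g x (t : R), Gammahat g x -> 0 < t < T -> Ups (Uplus u k g x t)) :
  let V := vander phi xv in
  let Vf g := vander phi (xf g) in
  let M := massmx V W in
  let P := projmx V W in
  let Mk k := phys_massmx V W (X k) xv in
  let f u k m e t := vol_flux phi xv X F u k m e t in
  let fstar u k g e t :=
    num_flux phi (xf g) X Fstar (nhat g) (nu k g) (Uplus u k g) u k e t in
  (* (i) *)
  (forall (m : 'I_d) (u v : 'rV[R]_d -> R),
     monomial_span E u -> monomial_span E v ->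
     nodal_form xv W u (partial m v) + nodal_form xv W (partial m u) v
     = \sum_g nhat g 0 m * nodal_form (xf g) (Wf g) u v) ->
  (* (ii) *)
  \rank V = Np -> spd W -> (forall g, spd (Wf g)) ->
  (* (iii) *)
  (forall k, Mk k \in unitmx) ->
  forall u : coeffs R NEq K Np, admissible Omegahat Ups phi T u ->
    (forall k e (t : R), 0 < t < T ->
       Mk k *m derive1 (u k e) t
       + \sum_m M *m D m *m P *m f u k m e t
       + \sum_g (Vf g)^T *m Wf g *m
           (fstar u k g e t - \sum_n nhat g 0 n *: (Vf g *m P *m f u k n e t))
       = 0)
    <->
    (forall k e (t : R), 0 < t < T ->
       Mk k *m derive1 (u k e) t
       - \sum_m (D m)^T *m V^T *m W *m f u k m e t
       + \sum_g (Vf g)^T *m Wf g *m fstar u k g e t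
       = 0).
Proof.
move=> V Vf M P Mk f fstar ibp rV spdW _ _ u _.
have [phiE _] := hphi.
have sbp m := summation_by_parts (hD m)
  (fun i j => ibp m (phi i) (phi j) (phiE i) (phiE j)).
have residualE k e t := strong_weak_residual (Mk k *m derive1 (u k e) t)
  (fun m => f u k m e t) (fun g => fstar u k g e t) rV spdW sbp.
by split=> eqn k e t t0T; have := eqn k e t t0T; rewrite residualE.
Qed.
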